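(* \[ \sum_{k=1}^{\infty}(8k+1)\frac{(\tfrac{1}{2})_k(\tfrac{1}{4})_k(\tfrac{3}{4})_k}{k!^3\,9^k}\sum_{i=1}^{k}\left\{\frac{1}{(2i-1)^2}-\frac{1}{36i^2}\right\}=\frac{\sqrt{3}\,\pi}{54}. \]
   Context: For a complex number $x$ and a nonnegative integer $n$, $(x)_n=\Gamma(x+n)/\Gamma(x)=x(x+1)\cdots(x+n-1)$ denotes the shifted factorial (Pochhammer symbol), with $(x)_0=1$. *)

(* Defs.v *)
From Stdlib Require Import Reals Arith Factorial.
From Coquelicot Require Import Coquelicot.
Open Scope R_scope.

Fixpoint poch (x : R) (n : nat) : R :=
  match n with
  | O => 1
  | S m => poch x m * (x + INR m)
  end.

Fixpoint inner (k : nat) : R :=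
  match k with
  | O => 0
  | S m => inner m + (1 / (2 * INR (S m) - 1) ^ 2 - 1 / (36 * INR (S m) ^ 2))
  end.

Definition term (k : nat) : R :=
  (8 * INR k + 1) *
  (poch (1/2) k * poch (1/4) k * poch (3/4) k / (INR (fact k) ^ 3 * 9 ^ k)) *
  inner k.

(* Main.v *)
(** The series is the x^2-coefficient of a deformation of Ramanujan's series.
    For a = 3 n + 1/2 put
      S(x, n) = sum_k (1 + 4 k / a) (1/2 + x)_k (1/2 - x)_k (a)_{2k}
                        / ((2k)! 9^k (n + 1 + x/3)_k (n + 1 - x/3)_k).
    A WZ pair gives S(x, n) = r_n S(x, n + 1) with
    r_n = ((n + 1)^2 - 1/36) / ((n + 1)^2 - x^2/9), and as n tends to infinity S(x, n) tends to
    sum_k (1/2 + x)_k (1/2 - x)_k / (2k)!, the value at t = PI/6 of the expansion of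
    cos (2 x t) / cos t in powers of sin^2 t.  The product of the r_n is a quotient of two sine
    products, which come from the recurrence of the integrals of cos (x t) cos^n t over
    [0, PI/2].  Altogether S(x, 0) = (2 / sqrt 3) x cot (PI x / 3), and
    (S(0, 0) - S(x, 0)) / x^2 tends termwise to four times the series of the theorem. *)

Require Import Defs.
From Stdlib Require Import Reals Factorial Lra Lia Psatz.
From Coquelicot Require Import Coquelicot.
Open Scope R_scope.

(** * Dominated convergence for series *)

Lemma Series_tail_small (M : nat -> R) (eps : posreal) :
  ex_series M ->
  exists N : nat, Rabs (Series (fun k => M (S N + k)%nat)) < eps.
Proof.
  intros HM.
  assert (H : is_lim_seq (sum_n M) (Series M)) by exact (Series_correct _ HM).
  apply is_lim_seq_spec in H. destruct (H eps) as [N HN].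
  exists N. specialize (HN N (le_n _)).
  rewrite (Series_incr_n M (S N)) in HN; [|lia|exact HM].
  rewrite <- sum_n_Reals in HN. simpl pred in HN.
  rewrite Rabs_minus_sym in HN.
  replace (sum_n M N + Series (fun k => M (S N + k)%nat) - sum_n M N)
    with (Series (fun k => M (S N + k)%nat)) in HN by ring.
  exact HN.
Qed.

Lemma dominated_ex_series (u M : nat -> R) :
  (forall k, Rabs (u k) <= M k) -> ex_series M -> ex_series u.
Proof. intros Hu HM. apply (ex_series_le u M); [exact Hu|exact HM]. Qed.

(** The tails past a common index [N] are all dominated by the tail of [M], hence smaller than
    [eps / 3] for every [n] at once; the finitely many remaining terms converge one by one. It
    serves both limits of the proof: [n] to infinity in the WZ iteration and [x] to 0 at the end. *)
Lemma tannery (u : nat -> nat -> R) (v M : nat -> R) :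
  (forall n k, Rabs (u n k) <= M k) -> ex_series M ->
  (forall k, is_lim_seq (fun n => u n k) (v k)) ->
  ex_series v /\ is_lim_seq (fun n => Series (u n)) (Series v).
Proof.
  intros Hu HM Hlim.
  assert (Hv : forall k, Rabs (v k) <= M k).
  { intros k.
    apply (is_lim_seq_le (fun n => Rabs (u n k)) (fun _ => M k) (Rabs (v k)) (M k)).
    - intros n; apply Hu.
    - apply (is_lim_seq_abs _ (v k)), Hlim.
    - apply is_lim_seq_const. }
  assert (Ev : ex_series v) by (apply (dominated_ex_series v M); auto).
  split; [exact Ev|].
  assert (Eu : forall n, ex_series (u n)) by (intros n; apply (dominated_ex_series _ M); auto).
  assert (tail : forall w N, (forall k, Rabs (w k) <= M k) ->
     Rabs (Series (fun k => w (S N + k)%nat)) <= Rabs (Series (fun k => M (S N + k)%nat))).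
  { intros w N Hw.
    assert (EM : ex_series (fun k => M (S N + k)%nat)) by (apply ex_series_incr_n; exact HM).
    eapply Rle_trans; [apply Series_Rabs|].
    { apply (dominated_ex_series _ (fun k => M (S N + k)%nat)); [|exact EM].
      intros k; rewrite Rabs_Rabsolu; apply Hw. }
    eapply Rle_trans; [apply Series_le; [|exact EM]|apply Rle_abs].
    intros k; split; [apply Rabs_pos|apply Hw]. }
  apply is_lim_seq_spec. intros eps.
  assert (H3 : 0 < eps / 3) by (destruct eps; simpl; lra).
  destruct (Series_tail_small M (mkposreal _ H3) HM) as [N HN].
  change (Rabs (Series (fun k => M (S N + k)%nat)) < eps / 3) in HN.
  assert (HS : is_lim_seq (fun n => sum_n (u n) N) (sum_n v N)).
  { clear HN. induction N as [|N IH].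
    - apply (is_lim_seq_ext (fun n => u n O)); [intros n; now rewrite sum_O|].
      rewrite sum_O; apply Hlim.
    - apply (is_lim_seq_ext (fun n => sum_n (u n) N + u n (S N)));
        [intros n; now rewrite sum_Sn|].
      rewrite sum_Sn. apply is_lim_seq_plus'; auto. }
  apply is_lim_seq_spec in HS. destruct (HS (mkposreal _ H3)) as [n0 Hn0].
  exists n0. intros n Hn. specialize (Hn0 n Hn). simpl in Hn0.
  rewrite (Series_incr_n (u n) (S N)); [|lia|apply Eu].
  rewrite (Series_incr_n v (S N)); [|lia|exact Ev].
  rewrite <- !sum_n_Reals. simpl pred.
  pose proof (tail (u n) N (Hu n)) as T1. pose proof (tail v N Hv) as T2.
  apply Rabs_def2 in Hn0. apply Rabs_le_between in T1. apply Rabs_le_between in T2.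
  destruct Hn0, T1, T2. apply Rabs_def1; lra.
Qed.

(** * Elementary trigonometric inequalities *)

Lemma Rabs_sin_le (u : R) : Rabs (sin u) <= Rabs u.
Proof.
  assert (H : forall v, 0 < v -> Rabs (sin v) <= v).
  { intros v Hv. destruct (Rle_dec v 1) as [H1|H1].
    - rewrite Rabs_pos_eq; [left; apply sin_lt_x; lra|].
      apply sin_ge_0; [lra|]. pose proof PI2_1; lra.
    - apply Rle_trans with 1; [apply Rabs_le, SIN_bound|lra]. }
  destruct (Rtotal_order u 0) as [Hu|[->|Hu]].
  - rewrite <- (Rabs_Ropp (sin u)), <- sin_neg, (Rabs_left u) by lra. apply H; lra.
  - rewrite sin_0; lra.
  - rewrite (Rabs_pos_eq u) by lra. apply H, Hu.
Qed.

Lemma one_minus_cos_le (u : R) : 0 <= 1 - cos u <= u ^ 2 / 2.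
Proof.
  split; [pose proof (COS_bound u); lra|].
  replace u with (2 * (u / 2)) at 1 by field.
  rewrite cos_2a_sin.
  pose proof (Rabs_sin_le (u / 2)) as H.
  apply Rsqr_le_abs_1 in H. unfold Rsqr in H. nra.
Qed.

(** The difference [sin s - s * cos s] vanishes at 0 and has derivative [s * sin s], which is
    nonnegative up to [PI]. *)
Lemma mult_cos_le_sin (t : R) : 0 <= t <= PI -> t * cos t <= sin t.
Proof.
  intros [H0 H1].
  destruct (MVT_gen (fun s => sin s - s * cos s) 0 t (fun s => s * sin s)) as [c [Hc E]].
  - intros s _. auto_derive; [trivial|ring].
  - intros s _. apply continuity_pt_filterlim.
    apply (ex_derive_continuous (fun s => sin s - s * cos s)). auto_derive; trivial.
  - rewrite Rmin_left, Rmax_right in Hc by lra.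
    rewrite sin_0 in E.
    assert (0 <= sin c) by (apply sin_ge_0; lra).
    assert (0 <= c * sin c * (t - 0)) by (apply Rmult_le_pos; [apply Rmult_le_pos|]; lra).
    lra.
Qed.

(** * Cosine integrals and the limit of the product of the WZ ratios *)

Definition cosI (n : nat) (x : R) : R := RInt (fun t => cos (x * t) * cos t ^ n) 0 (PI / 2).

Lemma cosI_continuous (n : nat) (x t : R) :
  continuous (fun t => cos (x * t) * cos t ^ n) t.
Proof.
  apply (ex_derive_continuous (fun t => cos (x * t) * cos t ^ n)). auto_derive; trivial.
Qed.

Lemma cosI_correct (n : nat) (x : R) :
  is_RInt (fun t => cos (x * t) * cos t ^ n) 0 (PI / 2) (cosI n x).
Proof.
  apply (RInt_correct (fun t => cos (x * t) * cos t ^ n)).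
  apply (ex_RInt_continuous (fun t => cos (x * t) * cos t ^ n)).
  intros z _; apply cosI_continuous.
Qed.

(** Two integrations by parts in one step: [D] is a primitive of the difference of the two
    integrands. It vanishes at 0 through the sines and at [PI / 2] through the positive powers of
    the cosine. *)
Lemma cosI_rec (n : nat) (x : R) :
  (INR (n + 2) ^ 2 - x ^ 2) * cosI (n + 2) x = INR (n + 2) * INR (n + 1) * cosI n x.
Proof.
  set (D := fun t => INR (n + 2) * (cos (x * t) * cos t ^ (n + 1) * sin t)
                     - x * (sin (x * t) * cos t ^ (n + 2))).
  set (d := fun t => (INR (n + 2) ^ 2 - x ^ 2) * (cos (x * t) * cos t ^ (n + 2))
                     - INR (n + 2) * INR (n + 1) * (cos (x * t) * cos t ^ n)).
  assert (H1 : is_RInt d 0 (PI / 2) (minus (D (PI / 2)) (D 0))).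
  { apply (is_RInt_derive D d).
    - intros t _. unfold D, d.
      replace (n + 2)%nat with (S (S n)) by lia.
      replace (n + 1)%nat with (S n) by lia.
      auto_derive; [trivial|]. simpl pred. simpl pow.
      assert (Hs : sin t * sin t = 1 - cos t * cos t).
      { pose proof (sin2_cos2 t) as H; unfold Rsqr in H; lra. }
      change (match n with O => 1 | S _ => INR n + 1 end) with (INR (S n)).
      rewrite !S_INR. ring [Hs].
    - intros t _. apply (ex_derive_continuous d). unfold d. auto_derive; trivial. }
  assert (H2 : is_RInt d 0 (PI / 2)
     (minus (scal (INR (n + 2) ^ 2 - x ^ 2) (cosI (n + 2) x))
            (scal (INR (n + 2) * INR (n + 1)) (cosI n x)))).
  { apply (is_RInt_minus (fun t => scal (INR (n + 2) ^ 2 - x ^ 2) (cos (x * t) * cos t ^ (n + 2)))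
       (fun t => scal (INR (n + 2) * INR (n + 1)) (cos (x * t) * cos t ^ n)));
    apply (is_RInt_scal (fun t => cos (x * t) * cos t ^ _)); apply cosI_correct. }
  apply (is_RInt_unique (V := R_CompleteNormedModule)) in H1.
  apply (is_RInt_unique (V := R_CompleteNormedModule)) in H2. rewrite H1 in H2.
  unfold D, minus, plus, opp, scal in H2; simpl in H2. unfold mult in H2; simpl in H2.
  rewrite cos_PI2, !Rmult_0_r, !sin_0 in H2.
  rewrite !pow_i in H2 by lia. lra.
Qed.

Lemma cosI_pos (n : nat) : 0 < cosI n 0.
Proof.
  unfold cosI. apply RInt_gt_0; [pose proof PI_RGT_0; lra| |].
  - intros t Ht. rewrite Rmult_0_l, cos_0, Rmult_1_l. apply pow_lt, cos_gt_0; lra.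
  - intros t _. apply cosI_continuous.
Qed.

(** The bound on [1 - cos (x * t)] leaves the integral of [t ^ 2 * cos t ^ (n + 2)], which is at
    most that of [cos t ^ n - cos t ^ (n + 2)]; the recurrence at [x = 0] evaluates the latter. The
    relative deficit is thus of order [1 / n]. *)
Lemma cosI_deficit (n : nat) (x : R) :
  0 <= cosI (n + 2) 0 - cosI (n + 2) x <= x ^ 2 / 2 * (cosI (n + 2) 0 / INR (n + 1)).
Proof.
  pose proof PI_RGT_0 as HPI.
  assert (HD : is_RInt (fun t => (1 - cos (x * t)) * cos t ^ (n + 2)) 0 (PI / 2)
                 (cosI (n + 2) 0 - cosI (n + 2) x)).
  { eapply is_RInt_ext; [|apply (is_RInt_minus _ _ _ _ _ _ (cosI_correct (n + 2) 0)
                                   (cosI_correct (n + 2) x))].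
    intros t _. simpl. unfold minus, plus, opp; simpl. rewrite Rmult_0_l, cos_0. ring. }
  assert (HU : is_RInt (fun t => x ^ 2 / 2 * (cos t ^ n - cos t ^ (n + 2))) 0 (PI / 2)
                 (x ^ 2 / 2 * (cosI n 0 - cosI (n + 2) 0))).
  { apply (is_RInt_scal (fun t => cos t ^ n - cos t ^ (n + 2))).
    eapply is_RInt_ext; [|apply (is_RInt_minus _ _ _ _ _ _ (cosI_correct n 0)
                                   (cosI_correct (n + 2) 0))].
    intros t _. simpl. unfold minus, plus, opp; simpl. rewrite Rmult_0_l, cos_0. ring. }
  assert (E : cosI n 0 - cosI (n + 2) 0 = cosI (n + 2) 0 / INR (n + 1)).
  { pose proof (cosI_rec n 0) as H.
    assert (H1 : 0 < INR (n + 1)) by (apply lt_0_INR; lia).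
    assert (H2 : 0 < INR (n + 2)) by (apply lt_0_INR; lia).
    assert (H3 : INR (n + 2) = INR (n + 1) + 1)
      by (rewrite <- S_INR; f_equal; lia).
    assert (H4 : INR (n + 1) * cosI n 0 = INR (n + 2) * cosI (n + 2) 0)
      by (apply Rmult_eq_reg_l with (INR (n + 2)); lra).
    apply Rmult_eq_reg_l with (INR (n + 1)); [|lra].
    field_simplify; [|lra]. rewrite H4, H3. ring. }
  rewrite <- E.
  assert (Hc : forall t, 0 < t < PI / 2 -> 0 <= cos t) by (intros t Ht; apply cos_ge_0; lra).
  split.
  - apply (is_RInt_ge_0 (fun t => (1 - cos (x * t)) * cos t ^ (n + 2)) 0 (PI / 2));
      [lra|exact HD|].
    intros t Ht. apply Rmult_le_pos; [apply one_minus_cos_le|apply pow_le, Hc, Ht].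
  - refine (is_RInt_le _ _ 0 (PI / 2) _ _ _ HD HU _); [lra|].
    intros t Ht.
    (* [t cos t <= sin t] trades [t^2 cos^2 t] for [1 - cos^2 t]. *)
    assert (H1 : (t * cos t) ^ 2 <= 1 - cos t ^ 2).
    { replace (1 - cos t ^ 2) with (sin t ^ 2)
        by (pose proof (sin2_cos2 t) as H; unfold Rsqr in H; lra).
      apply pow_incr. split; [apply Rmult_le_pos; [lra|apply Hc, Ht]|].
      apply mult_cos_le_sin; lra. }
    pose proof (one_minus_cos_le (x * t)) as [_ H2].
    pose proof (pow_le _ n (Hc t Ht)) as H3.
    rewrite pow_add.
    apply Rle_trans with ((x * t) ^ 2 / 2 * (cos t ^ n * cos t ^ 2)).
    { apply Rmult_le_compat_r; [|exact H2]. apply Rmult_le_pos; [exact H3|apply pow2_ge_0]. }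
    replace ((x * t) ^ 2 / 2 * (cos t ^ n * cos t ^ 2))
      with (x ^ 2 / 2 * (cos t ^ n * (t * cos t) ^ 2)) by field.
    apply Rmult_le_compat_l; [pose proof (pow2_ge_0 x); lra|].
    replace (cos t ^ n - cos t ^ n * cos t ^ 2) with (cos t ^ n * (1 - cos t ^ 2)) by ring.
    apply Rmult_le_compat_l; assumption.
Qed.

(** At [y = x / 3] this is the product of the factors [wz_ratio x m] for [m < n]. *)
Fixpoint ratio_prod (y : R) (n : nat) : R :=
  match n with
  | O => 1
  | S m => ratio_prod y m * ((INR (S m) ^ 2 - (1 / 6) ^ 2) / (INR (S m) ^ 2 - y ^ 2))
  end.

(** Numerator and denominator of each factor are a quarter of the coefficients in [cosI_rec] at
    [1 / 3] and at [2 * y], so the product telescopes. Cross-multiplication avoids any nonvanishing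
    condition on the integrals. *)
Lemma ratio_prod_cosI (y : R) (n : nat) : 0 <= y < 1 ->
  ratio_prod y n * (cosI (2 * n) (1 / 3) * cosI 0 (2 * y))
  = cosI 0 (1 / 3) * cosI (2 * n) (2 * y).
Proof.
  intros Hy. induction n as [|n IH]; [simpl; ring|].
  replace (2 * S n)%nat with (2 * n + 2)%nat by lia.
  pose proof (cosI_rec (2 * n) (1 / 3)) as H1.
  pose proof (cosI_rec (2 * n) (2 * y)) as H2.
  rewrite !plus_INR, mult_INR in H1, H2.
  cbn [ratio_prod]. rewrite S_INR.
  pose proof (pos_INR n) as Hn.
  replace (INR 2) with 2 in H1, H2 by (simpl; ring). change (INR 1) with 1 in H1, H2.
  set (m := INR n) in *.
  assert (Hd : 0 < (m + 1) ^ 2 - y ^ 2) by nra.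
  assert (Hk : 0 < (2 * m + 2) * (2 * m + 1)) by nra.
  (* Multiplying by the right-hand coefficient of the recurrence lets [H1] be used forwards and then
     [H2] backwards. *)
  apply Rmult_eq_reg_l with ((2 * m + 2) * (2 * m + 1)); [|lra].
  replace ((2 * m + 2) * (2 * m + 1) *
    (ratio_prod y n * (((m + 1) ^ 2 - (1 / 6) ^ 2) / ((m + 1) ^ 2 - y ^ 2)) *
      (cosI (2 * n + 2) (1 / 3) * cosI 0 (2 * y))))
   with (ratio_prod y n * (((2 * m + 2) ^ 2 - (1 / 3) ^ 2) * cosI (2 * n + 2) (1 / 3)) *
         cosI 0 (2 * y) * ((2 * m + 2) * (2 * m + 1)) / (4 * ((m + 1) ^ 2 - y ^ 2)))
   by (field; lra).
  rewrite H1.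
  replace (ratio_prod y n * ((2 * m + 2) * (2 * m + 1) * cosI (2 * n) (1 / 3)) *
    cosI 0 (2 * y) * ((2 * m + 2) * (2 * m + 1)) / (4 * ((m + 1) ^ 2 - y ^ 2)))
   with (ratio_prod y n * (cosI (2 * n) (1 / 3) * cosI 0 (2 * y)) *
     ((2 * m + 2) * (2 * m + 1)) * ((2 * m + 2) * (2 * m + 1)) / (4 * ((m + 1) ^ 2 - y ^ 2)))
   by (field; lra).
  rewrite IH.
  replace (cosI 0 (1 / 3) * cosI (2 * n) (2 * y) * ((2 * m + 2) * (2 * m + 1)) *
    ((2 * m + 2) * (2 * m + 1)) / (4 * ((m + 1) ^ 2 - y ^ 2)))
   with (cosI 0 (1 / 3) * ((2 * m + 2) * (2 * m + 1) * cosI (2 * n) (2 * y)) *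
    ((2 * m + 2) * (2 * m + 1)) / (4 * ((m + 1) ^ 2 - y ^ 2))) by (field; lra).
  rewrite <- H2. field. lra.
Qed.

(** A squeeze by [cosI_deficit]; the index is shifted first because that bound starts at exponent
    2. *)
Lemma cosI_ratio_lim (x : R) :
  is_lim_seq (fun n => cosI (2 * n) x / cosI (2 * n) 0) 1.
Proof.
  apply is_lim_seq_incr_1.
  apply is_lim_seq_le_le with (u := fun n => 1 - x ^ 2 / 2 * / INR (S n)) (w := fun _ => 1).
  - intros n. replace (2 * S n)%nat with (2 * n + 2)%nat by lia.
    pose proof (cosI_deficit (2 * n) x) as [H1 H2].
    pose proof (cosI_pos (2 * n + 2)) as H3.
    assert (H4 : / INR (2 * n + 1) <= / INR (S n)).
    { apply Rinv_le_contravar; [apply lt_0_INR|apply le_INR]; lia. }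
    assert (H5 : x ^ 2 / 2 * (cosI (2 * n + 2) 0 / INR (2 * n + 1))
       <= x ^ 2 / 2 * / INR (S n) * cosI (2 * n + 2) 0).
    { unfold Rdiv. pose proof (pow2_ge_0 x).
      replace (x ^ 2 * / 2 * (cosI (2 * n + 2) 0 * / INR (2 * n + 1))) with
        (x ^ 2 * / 2 * / INR (2 * n + 1) * cosI (2 * n + 2) 0) by ring.
      apply Rmult_le_compat_r; [lra|]. apply Rmult_le_compat_l; lra. }
    split.
    + apply Rmult_le_reg_r with (cosI (2 * n + 2) 0); [exact H3|].
      replace (cosI (2 * n + 2) x / cosI (2 * n + 2) 0 * cosI (2 * n + 2) 0)
        with (cosI (2 * n + 2) x) by (field; lra). lra.
    + apply Rmult_le_reg_r with (cosI (2 * n + 2) 0); [exact H3|].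
      replace (cosI (2 * n + 2) x / cosI (2 * n + 2) 0 * cosI (2 * n + 2) 0)
        with (cosI (2 * n + 2) x) by (field; lra). lra.
  - replace (Finite 1) with (Finite (1 - x ^ 2 / 2 * 0)) by (f_equal; ring).
    apply is_lim_seq_minus'; [apply is_lim_seq_const|].
    apply is_lim_seq_mult'; [apply is_lim_seq_const|].
    apply (is_lim_seq_inv (fun n => INR (S n)) p_infty).
    + apply (is_lim_seq_incr_1 INR), is_lim_seq_INR.
    + discriminate.
  - apply is_lim_seq_const.
Qed.

Lemma cosI_0_pos (x : R) : 0 <= x <= 1 -> 0 < cosI 0 x.
Proof.
  intros Hx. unfold cosI. pose proof PI_RGT_0. apply RInt_gt_0; [lra| |].
  - intros t Ht. rewrite Rmult_1_r. apply cos_gt_0; nra.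
  - intros t _. apply cosI_continuous.
Qed.

(** Dividing [ratio_prod_cosI] by [cosI (2 * n) 0] leaves two ratios that tend to 1, so only the
    integrals at exponent 0 survive. Their closed form in sines makes this a quotient of two Euler
    sine products. *)
Lemma ratio_prod_lim (y : R) : 0 <= y <= 1 / 2 ->
  is_lim_seq (ratio_prod y) (cosI 0 (1 / 3) / cosI 0 (2 * y)).
Proof.
  intros Hy.
  pose proof (cosI_0_pos (2 * y) ltac:(lra)) as HJ.
  assert (Hlim : is_lim_seq (fun n => cosI 0 (1 / 3) / cosI 0 (2 * y) *
       ((cosI (2 * n) (2 * y) / cosI (2 * n) 0) / (cosI (2 * n) (1 / 3) / cosI (2 * n) 0)))
     (cosI 0 (1 / 3) / cosI 0 (2 * y) * (1 / 1))).
  { apply is_lim_seq_mult'; [apply is_lim_seq_const|].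
    apply is_lim_seq_div'; [apply cosI_ratio_lim|apply cosI_ratio_lim|lra]. }
  replace (cosI 0 (1 / 3) / cosI 0 (2 * y) * (1 / 1))
    with (cosI 0 (1 / 3) / cosI 0 (2 * y)) in Hlim by (field; lra).
  revert Hlim. apply is_lim_seq_ext. intros n.
  pose proof (ratio_prod_cosI y n ltac:(lra)) as H.
  (* For [n > 0] the deficit at [1 / 3] is at most 1/18 of the positive value at 0. *)
  assert (H1 : 0 < cosI (2 * n) (1 / 3)).
  { destruct n as [|n]; [apply cosI_0_pos; lra|].
    replace (2 * S n)%nat with (2 * n + 2)%nat by lia.
    pose proof (cosI_deficit (2 * n) (1 / 3)) as [_ H1].
    pose proof (cosI_pos (2 * n + 2)) as H2.
    assert (H3 : / INR (2 * n + 1) <= 1).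
    { rewrite <- Rinv_1. apply Rinv_le_contravar; [lra|].
      apply (le_INR 1); lia. }
    assert (H4 : cosI (2 * n + 2) 0 / INR (2 * n + 1) <= cosI (2 * n + 2) 0).
    { rewrite <- (Rmult_1_r (cosI (2 * n + 2) 0)) at 2. apply Rmult_le_compat_l; lra. }
    lra. }
  pose proof (cosI_pos (2 * n)) as H2.
  apply Rmult_eq_reg_r with (cosI (2 * n) (1 / 3) * cosI 0 (2 * y)); [|nra].
  rewrite H. field. lra.
Qed.

Lemma cosI_0_eq (x : R) : x <> 0 -> cosI 0 x = sin (x * (PI / 2)) / x.
Proof.
  intros Hx. unfold cosI.
  apply is_RInt_unique.
  replace (sin (x * (PI / 2)) / x)
    with (minus (sin (x * (PI / 2)) / x) (sin (x * 0) / x)).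
  2: { unfold minus, plus, opp; simpl. rewrite Rmult_0_r, sin_0. field; exact Hx. }
  apply (is_RInt_derive (fun t => sin (x * t) / x)).
  - intros t _. auto_derive; [trivial|]. field; exact Hx.
  - intros t _. apply (cosI_continuous 0).
Qed.

Lemma cosI_0_0 : cosI 0 0 = PI / 2.
Proof.
  unfold cosI. rewrite (RInt_ext _ (fun _ => 1)).
  - rewrite RInt_const. unfold scal; simpl; unfold mult; simpl. ring.
  - intros t _. rewrite Rmult_0_l, cos_0. simpl; ring.
Qed.

(** * Expansion of [cos (2 x t) / cos t] in powers of [sin t ^ 2] *)

(** The coefficients [(1/2 + x)_k (1/2 - x)_k / ((1/2)_k k!)] of a Gauss hypergeometric series.
    Since [(2k)! = 4^k (1/2)_k k!], the extra [(1/4)^k] at [sin t ^ 2 = 1/4] produces the limit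
    series of the WZ iteration. *)
Fixpoint sin_coef (x : R) (k : nat) : R :=
  match k with
  | O => 1
  | S m => sin_coef x m * (((INR m + 1 / 2) ^ 2 - x ^ 2) / ((INR m + 1 / 2) * (INR m + 1)))
  end.

Lemma sin_coef_bound (x : R) (k : nat) : 0 <= x <= 1 / 2 -> 0 <= sin_coef x k <= 1.
Proof.
  intros Hx. induction k as [|k IH]; [simpl; lra|].
  cbn [sin_coef]. pose proof (pos_INR k) as Hk.
  set (q := ((INR k + 1 / 2) ^ 2 - x ^ 2) / ((INR k + 1 / 2) * (INR k + 1))).
  assert (Hq : 0 <= q <= 1).
  { assert (Hd : 0 < (INR k + 1 / 2) * (INR k + 1)) by nra.
    unfold q; split.
    - apply Rdiv_le_0_compat; [nra|exact Hd].
    - apply Rle_div_l; [exact Hd|nra]. }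
  split; [apply Rmult_le_pos; lra|].
  rewrite <- (Rmult_1_l 1). apply Rmult_le_compat; lra.
Qed.

Lemma CV_radius_bounded_coef (a : nat -> R) (C y : R) :
  (forall k, Rabs (a k) <= C) -> Rabs y < 1 -> Rbar_lt (Rabs y) (CV_radius a).
Proof.
  intros Ha Hy. apply Rbar_lt_le_trans with 1; [exact Hy|].
  apply (CV_radius_bounded a). exists C. intros n. rewrite pow1, Rmult_1_r. apply Ha.
Qed.

(* Coefficients, in powers of [sin t ^ 2], of [(cos t * f (sin t ^ 2))' / sin t],
   with [f] the series of [sin_coef]. *)
Definition dsin_coef (x : R) (k : nat) : R := - (4 * x ^ 2) / (2 * INR k + 1) * sin_coef x k.

Lemma sin_coef_disk (x y : R) : 0 <= x <= 1 / 2 -> Rabs y < 1 ->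
  Rbar_lt (Rabs y) (CV_radius (sin_coef x)).
Proof.
  intros Hx. apply CV_radius_bounded_coef with 1. intros k.
  pose proof (sin_coef_bound x k Hx). rewrite Rabs_pos_eq; lra.
Qed.

Lemma dsin_coef_disk (x y : R) : 0 <= x <= 1 / 2 -> Rabs y < 1 ->
  Rbar_lt (Rabs y) (CV_radius (dsin_coef x)).
Proof.
  intros Hx. apply CV_radius_bounded_coef with 1. intros k.
  pose proof (sin_coef_bound x k Hx). pose proof (pos_INR k).
  unfold dsin_coef. rewrite Rabs_mult.
  rewrite <- (Rmult_1_l 1).
  apply Rmult_le_compat; try apply Rabs_pos; [|rewrite Rabs_pos_eq; lra].
  rewrite Rabs_div by lra. rewrite Rabs_Ropp, !Rabs_pos_eq by nra.
  apply Rle_div_l; nra.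
Qed.

(** Coefficientwise this is the recursion of [sin_coef]. With [sin_series_second_order] it splits
    the hypergeometric equation into a first-order system for the two series. *)
Lemma sin_series_first_order (x y : R) : 0 <= x <= 1 / 2 -> Rabs y < 1 ->
  2 * (1 - y) * PSeries (PS_derive (sin_coef x)) y - PSeries (sin_coef x) y
  = PSeries (dsin_coef x) y.
Proof.
  intros Hx Hy.
  pose proof (sin_coef_disk x y Hx Hy) as HR.
  assert (HR' : Rbar_lt (Rabs y) (CV_radius (PS_derive (sin_coef x))))
    by (rewrite CV_radius_derive; exact HR).
  assert (E0 := CV_radius_inside _ _ HR). assert (E1 := CV_radius_inside _ _ HR').
  rewrite (PSeries_ext (dsin_coef x)
    (PS_minus (PS_scal 2 (PS_minus (PS_derive (sin_coef x)) (PS_incr_1 (PS_derive (sin_coef x)))))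
       (sin_coef x))).
  - rewrite PSeries_minus, PSeries_scal, PSeries_minus, PSeries_incr_1; [ring|exact E1| | |exact E0].
    + apply ex_pseries_incr_1, E1.
    + apply ex_pseries_scal; [apply Rmult_comm|].
      apply ex_pseries_minus; [exact E1|apply ex_pseries_incr_1, E1].
  - intros k. unfold PS_minus, PS_plus, PS_opp, PS_scal, PS_derive, PS_incr_1, dsin_coef,
      plus, opp, scal; simpl; unfold mult; simpl.
    destruct k as [|k].
    + simpl. unfold zero; simpl. field.
    + cbn [sin_coef]. rewrite !S_INR. pose proof (pos_INR k).
      change (match k with O => 1 | S _ => INR k + 1 end) with (INR (S k)).
      rewrite ?S_INR. field. lra.
Qed.

Lemma sin_series_second_order (x y : R) : 0 <= x <= 1 / 2 -> Rabs y < 1 ->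
  PSeries (dsin_coef x) y + 2 * y * PSeries (PS_derive (dsin_coef x)) y
  = - (4 * x ^ 2) * PSeries (sin_coef x) y.
Proof.
  intros Hx Hy.
  pose proof (dsin_coef_disk x y Hx Hy) as HR.
  assert (HR' : Rbar_lt (Rabs y) (CV_radius (PS_derive (dsin_coef x))))
    by (rewrite CV_radius_derive; exact HR).
  assert (E0 := CV_radius_inside _ _ HR). assert (E1 := CV_radius_inside _ _ HR').
  rewrite <- (PSeries_scal (- (4 * x ^ 2))).
  rewrite (PSeries_ext (PS_scal (- (4 * x ^ 2)) (sin_coef x))
    (PS_plus (dsin_coef x) (PS_scal 2 (PS_incr_1 (PS_derive (dsin_coef x)))))).
  - rewrite PSeries_plus, PSeries_scal, PSeries_incr_1; [ring|exact E0|].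
    apply ex_pseries_scal; [apply Rmult_comm|apply ex_pseries_incr_1, E1].
  - intros k. unfold PS_minus, PS_plus, PS_opp, PS_scal, PS_derive, PS_incr_1, dsin_coef,
      plus, opp, scal; simpl; unfold mult; simpl.
    destruct k as [|k].
    + simpl. unfold zero; simpl. field.
    + rewrite !S_INR. pose proof (pos_INR k).
      change (match k with O => 1 | S _ => INR k + 1 end) with (INR (S k)).
      rewrite ?S_INR. cbn [sin_coef]. field. lra.
Qed.

Lemma sin2_lt_1 (t : R) : - (PI / 2) < t < PI / 2 -> Rabs (sin t ^ 2) < 1.
Proof.
  intros Ht. pose proof (cos_gt_0 t ltac:(lra) ltac:(lra)) as Hc.
  pose proof (sin2_cos2 t) as H. unfold Rsqr in H.
  rewrite Rabs_pos_eq by apply pow2_ge_0. nra.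
Qed.

(** The difference [h] of the two sides solves [h'' = - 4 x^2 h] by the two series equations, with
    zero initial data. *)
Lemma cos_sin_series (x t : R) : 0 <= x <= 1 / 2 -> 0 <= t < PI / 2 ->
  cos t * PSeries (sin_coef x) (sin t ^ 2) = cos (2 * x * t).
Proof.
  intros Hx Ht.
  set (h := fun s => cos s * PSeries (sin_coef x) (sin s ^ 2) - cos (2 * x * s)).
  set (h1 := fun s => sin s * PSeries (dsin_coef x) (sin s ^ 2) + 2 * x * sin (2 * x * s)).
  (* The interval extends to both sides of 0, so that continuity at the left endpoint of [[0, t]]
     comes from differentiability. *)
  assert (Hd : forall s, - (PI / 2) < s < PI / 2 -> is_derive h s (h1 s)).
  { intros s Hs. pose proof (sin2_lt_1 s Hs) as Hy.
    pose proof (is_derive_PSeries _ _ (sin_coef_disk x _ Hx Hy)) as HD.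
    unfold h. auto_derive; [eexists; exact HD|].
    change (fun r : R => PSeries (sin_coef x) r) with (PSeries (sin_coef x)).
    change (sin s * (sin s * 1)) with (sin s ^ 2).
    rewrite (is_derive_unique _ _ _ HD).
    unfold h1. rewrite <- (sin_series_first_order x _ Hx Hy).
    pose proof (sin2_cos2 s) as E. unfold Rsqr in E.
    replace (1 - sin s ^ 2) with (cos s * cos s) by (simpl; lra). ring. }
  assert (Hd1 : forall s, - (PI / 2) < s < PI / 2 -> is_derive h1 s (- (4 * x ^ 2) * h s)).
  { intros s Hs. pose proof (sin2_lt_1 s Hs) as Hy.
    pose proof (is_derive_PSeries _ _ (dsin_coef_disk x _ Hx Hy)) as HD.
    unfold h1. auto_derive; [eexists; exact HD|].
    change (fun r : R => PSeries (dsin_coef x) r) with (PSeries (dsin_coef x)).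
    change (sin s * (sin s * 1)) with (sin s ^ 2).
    rewrite (is_derive_unique _ _ _ HD).
    pose proof (sin_series_second_order x _ Hx Hy) as E2.
    unfold h. rewrite Rmult_minus_distr_l.
    replace (- (4 * x ^ 2) * (cos s * PSeries (sin_coef x) (sin s ^ 2)))
      with (cos s * (- (4 * x ^ 2) * PSeries (sin_coef x) (sin s ^ 2))) by ring.
    rewrite <- E2. ring. }
  assert (const : forall f : R -> R, (forall s, - (PI / 2) < s < PI / 2 -> is_derive f s 0) ->
     f t = f 0).
  { intros f Hf. pose proof PI_RGT_0.
    destruct (MVT_gen f 0 t (fun _ => 0)) as [c [_ E]].
    - intros s Hs. rewrite Rmin_left, Rmax_right in Hs by lra. apply Hf; lra.
    - intros s Hs. rewrite Rmin_left, Rmax_right in Hs by lra.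
      apply continuity_pt_filterlim.
      apply (ex_derive_continuous f). exists 0. apply Hf; lra.
    - lra. }
  assert (h00 : h 0 = 0).
  { unfold h. rewrite cos_0, sin_0, Rmult_0_r, cos_0.
    replace (0 ^ 2) with 0 by ring. rewrite PSeries_0. simpl; ring. }
  (* The energy [h'^2 + 4 x^2 h^2] of the harmonic oscillator is conserved and starts at 0. *)
  assert (energy : forall s, 0 <= s < PI / 2 -> h1 s = 0).
  { intros s Hs.
    set (E := fun r => h1 r ^ 2 + 4 * x ^ 2 * h r ^ 2).
    assert (HE : forall r, - (PI / 2) < r < PI / 2 -> is_derive E r 0).
    { intros r Hr. unfold E.
      pose proof (Hd r Hr) as D0. pose proof (Hd1 r Hr) as D1.
      auto_derive; [split; [eexists; exact D1|split; [eexists; exact D0|trivial]]|].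
      rewrite (is_derive_unique (fun x0 : R => h1 x0) _ _ D1),
              (is_derive_unique (fun x0 : R => h x0) _ _ D0).
      ring. }
    pose proof PI_RGT_0.
    assert (Es : E s = E 0).
    { destruct (MVT_gen E 0 s (fun _ => 0)) as [c [_ Ec]].
      - intros r Hr. rewrite Rmin_left, Rmax_right in Hr by lra. apply HE; lra.
      - intros r Hr. rewrite Rmin_left, Rmax_right in Hr by lra.
        apply continuity_pt_filterlim.
        apply (ex_derive_continuous E). exists 0. apply HE; lra.
      - lra. }
    unfold E in Es. rewrite h00 in Es.
    assert (h10 : h1 0 = 0) by (unfold h1; rewrite Rmult_0_r, sin_0; ring).
    rewrite h10 in Es.
    pose proof (pow2_ge_0 x). pose proof (pow2_ge_0 (h s)). pose proof (pow2_ge_0 (h1 s)).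
    assert (0 <= 4 * x ^ 2 * h s ^ 2) by (apply Rmult_le_pos; lra).
    assert (Hz : h1 s ^ 2 = 0) by lra.
    apply Rsqr_0_uniq. unfold Rsqr. lra. }
  (* At [x = 0] the energy controls only [h1], so [h = 0] is deduced from [h1 = 0] by the mean value
     theorem. *)
  pose proof PI_RGT_0.
  destruct (MVT_gen h 0 t h1) as [c [Hc E]].
  - intros s Hs. rewrite Rmin_left, Rmax_right in Hs by lra. apply Hd; lra.
  - intros s Hs. rewrite Rmin_left, Rmax_right in Hs by lra.
    apply continuity_pt_filterlim.
    apply (ex_derive_continuous h). eexists. apply Hd; lra.
  - rewrite Rmin_left, Rmax_right in Hc by lra.
    rewrite (energy c) in E by lra. rewrite h00 in E. unfold h in E. lra.
Qed.

(** * The WZ pair and the closed form *)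

(* [wz_term x n k] is the [k]-th term of the series [S(x, n)] above. *)
Fixpoint wz (x : R) (n k : nat) : R :=
  match k with
  | O => 1
  | S j => wz x n j *
      (((INR j + 1 / 2) ^ 2 - x ^ 2) *
       ((3 * INR n + 2 * INR j + 1 / 2) * (3 * INR n + 2 * INR j + 3 / 2)) /
       ((2 * INR j + 1) * (2 * INR j + 2) * (9 * (INR n + INR j + 1) ^ 2 - x ^ 2)))
  end.

Definition wz_term (x : R) (n k : nat) : R := (1 + 8 * INR k / (6 * INR n + 1)) * wz x n k.

(** The ratio of consecutive terms splits into a factor at most 1/4 and a factor at most 1.
    Uniformity in [n] and [x] is what dominated convergence requires. *)
Lemma wz_bound (x : R) (n k : nat) : 0 <= x <= 1 / 2 -> 0 <= wz x n k <= (1 / 4) ^ k.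
Proof.
  intros Hx. induction k as [|k IH]; [simpl; lra|].
  rewrite <- tech_pow_Rmult. cbn [wz]. pose proof (pos_INR k) as Hk. pose proof (pos_INR n) as Hn.
  set (j := INR k) in *. set (m := INR n) in *.
  assert (Hp : 0 <= ((j + 1 / 2) ^ 2 - x ^ 2) / ((2 * j + 1) * (2 * j + 2)) <= 1 / 4).
  { split; [apply Rdiv_le_0_compat; nra|]. apply Rle_div_l; nra. }
  assert (Hq : 0 <= (3 * m + 2 * j + 1 / 2) * (3 * m + 2 * j + 3 / 2) /
       (9 * (m + j + 1) ^ 2 - x ^ 2) <= 1).
  { assert (0 < 9 * (m + j + 1) ^ 2 - x ^ 2) by nra.
    split; [apply Rdiv_le_0_compat; nra|]. apply Rle_div_l; nra. }
  replace (((j + 1 / 2) ^ 2 - x ^ 2) *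
       ((3 * m + 2 * j + 1 / 2) * (3 * m + 2 * j + 3 / 2)) /
       ((2 * j + 1) * (2 * j + 2) * (9 * (m + j + 1) ^ 2 - x ^ 2)))
    with (((j + 1 / 2) ^ 2 - x ^ 2) / ((2 * j + 1) * (2 * j + 2)) *
      ((3 * m + 2 * j + 1 / 2) * (3 * m + 2 * j + 3 / 2) /
       (9 * (m + j + 1) ^ 2 - x ^ 2))) by (field; nra).
  set (p := ((j + 1 / 2) ^ 2 - x ^ 2) / ((2 * j + 1) * (2 * j + 2))) in *.
  set (q := (3 * m + 2 * j + 1 / 2) * (3 * m + 2 * j + 3 / 2) /
       (9 * (m + j + 1) ^ 2 - x ^ 2)) in *.
  assert (0 <= p * q <= 1 / 4) by nra.
  split; [apply Rmult_le_pos; lra|].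
  rewrite (Rmult_comm (1 / 4)). apply Rmult_le_compat; lra.
Qed.

(** Bernoulli's inequality for [(3/2)^k], squared. The base 9/4 is below 4, so a quadratic factor
    still leaves a geometric bound against [(1/4)^k]. *)
Lemma INR_sqr_le_pow (k : nat) : INR k ^ 2 <= 4 * (9 / 4) ^ k.
Proof.
  pose proof (poly k (1 / 2) ltac:(lra)) as H.
  replace (9 / 4) with ((1 + 1 / 2) ^ 2) by field.
  rewrite <- pow_mult, Nat.mul_comm, pow_mult.
  pose proof (pos_INR k).
  replace (INR k ^ 2) with (4 * (INR k * (1 / 2)) ^ 2) by field.
  apply Rmult_le_compat_l; [lra|]. apply pow_incr. lra.
Qed.

Lemma ex_series_quadratic_geom (C : R) : ex_series (fun k => C * (9 / 16) ^ k).
Proof.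
  apply (ex_series_scal C (fun k => (9 / 16) ^ k)).
  apply ex_series_geom. rewrite Rabs_pos_eq; lra.
Qed.

Lemma pow_4_9 (k : nat) : (9 / 4) ^ k * (1 / 4) ^ k = (9 / 16) ^ k.
Proof. rewrite <- Rpow_mult_distr. f_equal. field. Qed.

Lemma INR_sqr_quarter_le (k : nat) : INR k ^ 2 * (1 / 4) ^ k <= 4 * (9 / 16) ^ k.
Proof.
  rewrite <- pow_4_9, <- Rmult_assoc.
  apply Rmult_le_compat_r; [apply pow_le; lra|apply INR_sqr_le_pow].
Qed.

Lemma wz_term_bound (x : R) (n k : nat) : 0 <= x <= 1 / 2 ->
  Rabs (wz_term x n k) <= 36 * (9 / 16) ^ k.
Proof.
  intros Hx. unfold wz_term. pose proof (wz_bound x n k Hx) as [H0 H1].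
  pose proof (pos_INR k) as Hk. pose proof (pos_INR n) as Hn.
  assert (Hc : 0 <= 8 * INR k / (6 * INR n + 1) <= 8 * INR k).
  { split; [apply Rdiv_le_0_compat; lra|]. apply Rle_div_l; [lra|]. nra. }
  rewrite Rabs_pos_eq by (apply Rmult_le_pos; lra).
  (* The index 0 is separate, as the bound of the linear factor by [9 * INR k ^ 2] needs [k >= 1];
     the constant is [36 = 9 * 4]. *)
  destruct k as [|k]; [simpl in *; lra|].
  assert (1 <= INR (S k)) by (apply (le_INR 1); lia).
  apply Rle_trans with (9 * (INR (S k) ^ 2 * (1 / 4) ^ S k)).
  - rewrite <- Rmult_assoc. apply Rmult_le_compat; [lra|lra|nra|lra].
  - pose proof (INR_sqr_quarter_le (S k)). lra.
Qed.

Lemma wz_term_ex_series (x : R) (n : nat) : 0 <= x <= 1 / 2 -> ex_series (wz_term x n).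
Proof.
  intros Hx. apply (dominated_ex_series _ (fun k => 36 * (9 / 16) ^ k)).
  - intros k. apply wz_term_bound, Hx.
  - apply ex_series_quadratic_geom.
Qed.

Definition wz_ratio (x : R) (n : nat) : R :=
  (INR (S n) ^ 2 - (1 / 6) ^ 2) / (INR (S n) ^ 2 - (x / 3) ^ 2).

(** Raising [n] by 1 raises [a] by 3, so [(a + 3)_{2k} / (a)_{2k}] collapses to three factors over
    three, and the quotient of the denominators collapses likewise. Both rows of the WZ pair thereby
    become rational multiples of [wz x n k]. *)
Lemma wz_shift (x : R) (n k : nat) : 0 <= x <= 1 / 2 ->
  let a := 3 * INR n + 1 / 2 in
  wz x (S n) k = wz x n k *
    ((a + 2 * INR k) * (a + 2 * INR k + 1) * (a + 2 * INR k + 2) /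
     (a * (a + 1) * (a + 2)) *
     ((9 * (INR n + 1) ^ 2 - x ^ 2) / (9 * (INR n + INR k + 1) ^ 2 - x ^ 2))).
Proof.
  intros Hx a. unfold a. clear a. pose proof (pos_INR n) as Hn.
  induction k as [|k IH].
  - cbn [wz]. simpl INR. field. repeat split; nra.
  - cbn [wz]. rewrite IH, !S_INR. pose proof (pos_INR k) as Hk.
    set (j := INR k) in *. set (m := INR n) in *.
    field. repeat split; nra.
Qed.

(** The WZ companion. Its factor [2k (2k - 1)] cancels the last two factors of [(2k)!] and makes it
    vanish at [k = 0], where the telescoping starts; its denominator is [a (a + 1)]. *)
Definition wz_cert (x : R) (n k : nat) : R :=
  2 * INR k * (2 * INR k - 1) / ((3 * INR n + 1 / 2) * (3 * INR n + 3 / 2)) * wz x n k.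

Lemma wz_pair (x : R) (n k : nat) : 0 <= x <= 1 / 2 ->
  wz_term x n k - wz_ratio x n * wz_term x (S n) k = wz_cert x n (S k) - wz_cert x n k.
Proof.
  intros Hx. unfold wz_term, wz_ratio, wz_cert.
  rewrite (wz_shift x n k Hx). cbn [wz]. rewrite !S_INR.
  pose proof (pos_INR k) as Hk. pose proof (pos_INR n) as Hn.
  set (j := INR k) in *. set (m := INR n) in *.
  field. repeat split; nra.
Qed.

Lemma sum_wz_pair (x : R) (n K : nat) : 0 <= x <= 1 / 2 ->
  sum_n (fun k => wz_term x n k - wz_ratio x n * wz_term x (S n) k) K = wz_cert x n (S K).
Proof.
  intros Hx. induction K as [|K IH].
  - rewrite sum_O, wz_pair by exact Hx.
    replace (wz_cert x n 0) with 0 by (unfold wz_cert; simpl; unfold Rdiv; ring).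
    apply Rminus_0_r.
  - rewrite sum_Sn, IH, wz_pair by exact Hx. apply Rplus_minus.
Qed.

Lemma wz_cert_lim (x : R) (n : nat) : 0 <= x <= 1 / 2 -> is_lim_seq (wz_cert x n) 0.
Proof.
  intros Hx.
  apply is_lim_seq_le_le with (u := fun _ => 0) (w := fun k => 64 * (9 / 16) ^ k).
  - intros k. pose proof (wz_bound x n k Hx) as [H0 H1].
    pose proof (pos_INR k) as Hk. pose proof (pos_INR n) as Hn. unfold wz_cert.
    set (D := (3 * INR n + 1 / 2) * (3 * INR n + 3 / 2)).
    assert (HD : 3 / 4 <= D) by (unfold D; nra).
    assert (Hc : 0 <= 2 * INR k * (2 * INR k - 1)).
    { destruct k as [|k]; [simpl; lra|].
      assert (1 <= INR (S k)) by (apply (le_INR 1); lia). nra. }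
    split; [apply Rmult_le_pos; [apply Rdiv_le_0_compat; lra|exact H0]|].
    (* Since [D >= 3/4], the rational factor is at most [16/3 * INR k ^ 2]; the rounded 16 times 4
       gives 64. *)
    apply Rle_trans with (16 * (INR k ^ 2 * (1 / 4) ^ k)).
    + rewrite <- Rmult_assoc. apply Rmult_le_compat; [apply Rdiv_le_0_compat; lra|lra| |lra].
      apply Rle_div_l; [lra|]. nra.
    + pose proof (INR_sqr_quarter_le k). lra.
  - apply is_lim_seq_const.
  - replace (Finite 0) with (Finite (64 * 0)) by (f_equal; ring).
    apply is_lim_seq_mult'; [apply is_lim_seq_const|].
    apply is_lim_seq_geom. rewrite Rabs_pos_eq; lra.
Qed.

Lemma wz_series_step (x : R) (n : nat) : 0 <= x <= 1 / 2 ->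
  Series (wz_term x n) = wz_ratio x n * Series (wz_term x (S n)).
Proof.
  intros Hx. pose proof (wz_term_ex_series x n Hx) as E0.
  pose proof (wz_term_ex_series x (S n) Hx) as E1.
  assert (H : is_series (fun k => wz_term x n k - wz_ratio x n * wz_term x (S n) k) 0).
  { assert (L : is_lim_seq
       (sum_n (fun k => wz_term x n k - wz_ratio x n * wz_term x (S n) k)) 0); [|exact L].
    apply (is_lim_seq_ext (fun K => wz_cert x n (S K))).
    - intros K. symmetry. apply sum_wz_pair, Hx.
    - apply (is_lim_seq_incr_1 (wz_cert x n)), wz_cert_lim, Hx. }
  apply is_series_unique in H.
  rewrite Series_minus, Series_scal_l in H; [lra|exact E0|].
  exact (ex_series_scal (wz_ratio x n) (wz_term x (S n)) E1).
Qed.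

Lemma wz_series_iter (x : R) (n : nat) : 0 <= x <= 1 / 2 ->
  Series (wz_term x 0) = ratio_prod (x / 3) n * Series (wz_term x n).
Proof.
  intros Hx. induction n as [|n IH]; [simpl; ring|].
  rewrite IH, wz_series_step by exact Hx. unfold wz_ratio. cbn [ratio_prod]. ring.
Qed.

Lemma is_lim_seq_inv_affine (c : R) : 0 < c ->
  is_lim_seq (fun n => / (INR n + c)) 0.
Proof.
  intros Hc. apply (is_lim_seq_inv (fun n => INR n + c) p_infty); [|discriminate].
  apply (is_lim_seq_plus INR (fun _ => c) p_infty c p_infty);
    [apply is_lim_seq_INR|apply is_lim_seq_const|reflexivity].
Qed.

Lemma wz_lim (x : R) (k : nat) : 0 <= x <= 1 / 2 ->
  is_lim_seq (fun n => wz x n k) (sin_coef x k * (1 / 4) ^ k).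
Proof.
  intros Hx. induction k as [|k IH].
  - simpl. rewrite Rmult_1_r. apply is_lim_seq_const.
  - rewrite <- tech_pow_Rmult. cbn [wz sin_coef]. pose proof (pos_INR k) as Hk. set (j := INR k) in *.
    set (p := ((j + 1 / 2) ^ 2 - x ^ 2) / ((2 * j + 1) * (2 * j + 2))).
    (* In terms of [e = 1 / (n + j + 1)] the [n]-dependent factor is regular at [e = 0]. *)
    assert (L : is_lim_seq (fun n => wz x n k *
      (p * ((3 + (- j - 5 / 2) * / (INR n + (j + 1))) *
            (3 + (- j - 3 / 2) * / (INR n + (j + 1))) /
        (9 - x ^ 2 * (/ (INR n + (j + 1)) * / (INR n + (j + 1)))))))
      (sin_coef x k * (1 / 4) ^ k *
        (p * ((3 + (- j - 5 / 2) * 0) * (3 + (- j - 3 / 2) * 0) / (9 - x ^ 2 * (0 * 0)))))).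
    { pose proof (is_lim_seq_inv_affine (j + 1) ltac:(lra)) as Le.
      apply is_lim_seq_mult'; [exact IH|].
      apply is_lim_seq_mult'; [apply is_lim_seq_const|].
      apply is_lim_seq_div'; [| |lra].
      - apply is_lim_seq_mult'; (apply is_lim_seq_plus'; [apply is_lim_seq_const|]);
        (apply is_lim_seq_mult'; [apply is_lim_seq_const|exact Le]).
      - apply is_lim_seq_minus'; [apply is_lim_seq_const|].
        apply is_lim_seq_mult'; [apply is_lim_seq_const|].
        apply is_lim_seq_mult'; exact Le. }
    replace (sin_coef x k * (((j + 1 / 2) ^ 2 - x ^ 2) / ((j + 1 / 2) * (j + 1))) *
       (1 / 4 * (1 / 4) ^ k))
     with (sin_coef x k * (1 / 4) ^ k *
        (p * ((3 + (- j - 5 / 2) * 0) * (3 + (- j - 3 / 2) * 0) / (9 - x ^ 2 * (0 * 0)))))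
     by (unfold p; field; nra).
    revert L. apply is_lim_seq_ext. intros n. pose proof (pos_INR n) as Hn.
    unfold p. set (m := INR n) in *. field. repeat split; nra.
Qed.

Lemma wz_term_lim (x : R) (k : nat) : 0 <= x <= 1 / 2 ->
  is_lim_seq (fun n => wz_term x n k) (sin_coef x k * (1 / 4) ^ k).
Proof.
  intros Hx. unfold wz_term.
  replace (sin_coef x k * (1 / 4) ^ k) with
    ((1 + 8 * INR k * (/ 6 * 0)) * (sin_coef x k * (1 / 4) ^ k)) by ring.
  apply is_lim_seq_mult'; [|apply wz_lim, Hx].
  apply is_lim_seq_plus'; [apply is_lim_seq_const|].
  apply is_lim_seq_mult'; [apply is_lim_seq_const|].
  apply is_lim_seq_ext with (fun n => / 6 * / (INR n + 1 / 6)).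
  - intros n. pose proof (pos_INR n). field. lra.
  - apply is_lim_seq_mult'; [apply is_lim_seq_const|].
    apply is_lim_seq_inv_affine; lra.
Qed.

(** [wz_series_iter] holds for every [n], so its right-hand side may be taken to the limit: the
    product by [ratio_prod_lim], the series by [tannery], with [cos_sin_series] at [PI / 6]. Leaving
    the integrals unevaluated covers [x = 0] in the same formula. *)
Lemma wz_series_closed_form (x : R) : 0 <= x <= 1 / 2 ->
  Series (wz_term x 0) =
  cosI 0 (1 / 3) / cosI 0 (2 * (x / 3)) * (2 / sqrt 3 * cos (x * PI / 3)).
Proof.
  intros Hx.
  destruct (tannery (fun n => wz_term x n) (fun k => sin_coef x k * (1 / 4) ^ k)
    (fun k => 36 * (9 / 16) ^ k)) as [_ L].
  - intros n k. apply wz_term_bound, Hx.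
  - apply ex_series_quadratic_geom.
  - intros k. apply wz_term_lim, Hx.
  - assert (E : Series (fun k => sin_coef x k * (1 / 4) ^ k) = 2 / sqrt 3 * cos (x * PI / 3)).
    { pose proof PI_RGT_0.
      pose proof (cos_sin_series x (PI / 6) Hx ltac:(lra)) as H1.
      rewrite sin_PI6, cos_PI6 in H1. replace ((1 / 2) ^ 2) with (1 / 4) in H1 by field.
      unfold PSeries in H1.
      replace (2 * x * (PI / 6)) with (x * PI / 3) in H1 by field.
      rewrite <- H1. assert (0 < sqrt 3) by (apply sqrt_lt_R0; lra). field. lra. }
    rewrite E in L.
    pose proof (is_lim_seq_mult' _ _ _ _ (ratio_prod_lim (x / 3) ltac:(lra)) L) as L2.
    assert (L3 : is_lim_seq (fun n => ratio_prod (x / 3) n * Series (wz_term x n))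
                   (Series (wz_term x 0))).
    { apply is_lim_seq_ext with (fun _ => Series (wz_term x 0)).
      - intros n. apply wz_series_iter, Hx.
      - apply is_lim_seq_const. }
    apply is_lim_seq_unique in L2. apply is_lim_seq_unique in L3.
    rewrite L2 in L3. injection L3 as L3. symmetry. exact L3.
Qed.

(** * The second-order coefficient at [x = 0] *)

(** The quotient of [wz x 0 k] by [wz 0 0 k], as [wz_defect] shows. *)
Fixpoint defect (x : R) (k : nat) : R :=
  match k with
  | O => 1
  | S j => defect x j *
      ((1 - 4 * x ^ 2 / (2 * INR (S j) - 1) ^ 2) / (1 - x ^ 2 / (9 * INR (S j) ^ 2)))
  end.

(* [(1 - defect x k) / x ^ 2], extended to [x = 0]. *)
Fixpoint defect_slope (x : R) (k : nat) : R :=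
  match k with
  | O => 0
  | S j => defect_slope x j +
      defect x j * ((4 / (2 * INR (S j) - 1) ^ 2 - 1 / (9 * INR (S j) ^ 2)) /
                    (1 - x ^ 2 / (9 * INR (S j) ^ 2)))
  end.

Lemma defect_slope_eq (x : R) (k : nat) : 0 <= x <= 1 / 2 ->
  1 - defect x k = x ^ 2 * defect_slope x k.
Proof.
  intros Hx. induction k as [|k IH]; [simpl; ring|].
  cbn [defect defect_slope]. rewrite Rmult_plus_distr_l, <- IH, S_INR.
  pose proof (pos_INR k). field. repeat split; nra.
Qed.

(** The bounds feed each other: the increments of the slope use [defect] in [[0, 1]], while
    [defect <= 1] at the next index follows from the slope being nonnegative. Each increment is at
    most [4 / (4/5) = 5]. *)
Lemma defect_bounds (x : R) (k : nat) : 0 <= x <= 1 / 2 ->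
  0 <= defect x k <= 1 /\ 0 <= defect_slope x k <= 5 * INR k.
Proof.
  intros Hx. induction k as [|k [[A1 A2] [B1 B2]]]; [simpl; lra|].
  pose proof (pos_INR k) as Hk.
  assert (Hs : 0 <= defect_slope x (S k) <= 5 * INR (S k)).
  { cbn [defect_slope]. rewrite S_INR. set (j := INR k) in *.
    assert (Hd : 0 < 9 * (j + 1) ^ 2) by nra.
    assert (Ha : 1 <= (2 * (j + 1) - 1) ^ 2) by nra.
    assert (Hp : 0 <= 4 / (2 * (j + 1) - 1) ^ 2 - 1 / (9 * (j + 1) ^ 2) <= 4).
    { assert (H1 : 4 / (2 * (j + 1) - 1) ^ 2 <= 4) by (apply Rle_div_l; nra).
      assert (H2 : 0 <= 1 / (9 * (j + 1) ^ 2)) by (apply Rdiv_le_0_compat; lra).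
      assert (H3 : 1 / (9 * (j + 1) ^ 2) <= 4 / (2 * (j + 1) - 1) ^ 2).
      { apply Rle_div_l; [lra|].
        replace (4 / (2 * (j + 1) - 1) ^ 2 * (9 * (j + 1) ^ 2))
          with (36 * (j + 1) ^ 2 / (2 * (j + 1) - 1) ^ 2) by (field; lra).
        apply Rle_div_r; nra. }
      lra. }
    assert (Hq : 4 / 5 <= 1 - x ^ 2 / (9 * (j + 1) ^ 2)).
    { assert (x ^ 2 / (9 * (j + 1) ^ 2) <= 1 / 5) by (apply Rle_div_l; nra). lra. }
    set (p := 4 / (2 * (j + 1) - 1) ^ 2 - 1 / (9 * (j + 1) ^ 2)) in *.
    set (q := 1 - x ^ 2 / (9 * (j + 1) ^ 2)) in *.
    assert (Hpq : 0 <= p / q <= 5).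
    { split; [apply Rdiv_le_0_compat; lra|apply Rle_div_l; lra]. }
    nra. }
  split; [|exact Hs].
  pose proof (defect_slope_eq x (S k) Hx) as E.
  assert (0 <= x ^ 2 * defect_slope x (S k)) by (apply Rmult_le_pos; [nra|lra]).
  split; [|lra].
  cbn [defect]. rewrite S_INR. apply Rmult_le_pos; [exact A1|].
  apply Rdiv_le_0_compat.
  - assert (4 * x ^ 2 / (2 * (INR k + 1) - 1) ^ 2 <= 1) by (apply Rle_div_l; nra). lra.
  - assert (x ^ 2 / (9 * (INR k + 1) ^ 2) <= 1 / 5) by (apply Rle_div_l; nra). lra.
Qed.

Lemma wz_defect (x : R) (k : nat) : 0 <= x <= 1 / 2 ->
  wz x 0 k = wz 0 0 k * defect x k.
Proof.
  intros Hx. induction k as [|k IH]; [simpl; ring|].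
  cbn [wz defect]. rewrite IH, S_INR. simpl (INR 0).
  pose proof (pos_INR k). field. repeat split; nra.
Qed.

(** Behind the induction are the duplications [(1/2)_{2k} = 4^k (1/4)_k (3/4)_k] and
    [(2k)! = 4^k (1/2)_k k!]. *)
Lemma wz_poch (k : nat) :
  wz 0 0 k = poch (1/2) k * poch (1/4) k * poch (3/4) k / (INR (fact k) ^ 3 * 9 ^ k).
Proof.
  induction k as [|k IH]; [simpl; field|].
  pose proof (pos_INR k) as Hk.
  assert (Hf : INR (fact k) <> 0) by apply INR_fact_neq_0.
  assert (H9 : 9 ^ k <> 0) by (apply pow_nonzero; lra).
  cbn [wz poch]. rewrite IH, fact_simpl, mult_INR, S_INR. change (9 ^ S k) with (9 * 9 ^ k).
  simpl (INR 0). field. repeat split; try assumption; nra.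
Qed.

Lemma defect_lim (k : nat) :
  is_lim_seq (fun n => defect (/ (INR n + 2)) k) 1 /\
  is_lim_seq (fun n => defect_slope (/ (INR n + 2)) k) (4 * inner k).
Proof.
  pose proof (is_lim_seq_inv_affine 2 ltac:(lra)) as Le.
  assert (Le2 : forall c, is_lim_seq (fun n => c * (/ (INR n + 2)) ^ 2) (c * 0)).
  { intros c. apply is_lim_seq_mult'; [apply is_lim_seq_const|].
    replace (Finite 0) with (Finite (0 * (0 * 1))) by (f_equal; ring).
    apply is_lim_seq_mult'; [exact Le|].
    apply is_lim_seq_mult'; [exact Le|apply is_lim_seq_const]. }
  induction k as [|k [IH1 IH2]].
  { split; simpl; [|rewrite Rmult_0_r]; apply is_lim_seq_const. }
  pose proof (pos_INR k) as Hk.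
  assert (HK : 1 <= INR (S k)) by (rewrite S_INR; lra).
  assert (Lq : is_lim_seq (fun n => 1 - (/ (INR n + 2)) ^ 2 / (9 * INR (S k) ^ 2)) 1).
  { replace (Finite 1) with (Finite (1 - / (9 * INR (S k) ^ 2) * 0)) by (f_equal; ring).
    apply is_lim_seq_minus'; [apply is_lim_seq_const|].
    apply is_lim_seq_ext with (fun n => / (9 * INR (S k) ^ 2) * (/ (INR n + 2)) ^ 2);
      [intros n; unfold Rdiv; ring|apply Le2]. }
  split; cbn [defect defect_slope].
  - replace (Finite 1) with
      (Finite (1 * ((1 - 4 / (2 * INR (S k) - 1) ^ 2 * 0) / 1))) by (f_equal; field; nra).
    apply is_lim_seq_mult'; [exact IH1|].
    apply is_lim_seq_div'; [|exact Lq|lra].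
    apply is_lim_seq_minus'; [apply is_lim_seq_const|].
    apply is_lim_seq_ext with (fun n => 4 / (2 * INR (S k) - 1) ^ 2 * (/ (INR n + 2)) ^ 2);
      [intros n; unfold Rdiv; ring|apply Le2].
  - replace (4 * inner (S k)) with (4 * inner k +
       1 * ((4 / (2 * INR (S k) - 1) ^ 2 - 1 / (9 * INR (S k) ^ 2)) / 1))
      by (cbn [inner]; field; nra).
    apply is_lim_seq_plus'; [exact IH2|].
    apply is_lim_seq_mult'; [exact IH1|].
    apply is_lim_seq_div'; [apply is_lim_seq_const|exact Lq|lra].
Qed.

(** The middle expression is [(1 - u cot u) / u^2]. Its numerator is bounded by Taylor polynomials
    of sine and cosine; its denominator uses [sin u < u] for the lower bound and
    [u - u^3 / 6 <= sin u] for the upper one. *)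
Lemma cot_defect_bounds (u : R) : 0 < u <= 1 ->
  1 / 3 - u ^ 2 / 24 <= (sin u - u * cos u) / (u ^ 2 * sin u)
    <= (1 / 3 + u ^ 2 / 120) / (1 - u ^ 2 / 6).
Proof.
  intros Hu. pose proof PI2_1 as HPI.
  destruct (sin_bound u 0 ltac:(lra) ltac:(lra)) as [S1 S2].
  destruct (cos_bound u 0 ltac:(lra) ltac:(lra)) as [C1 C2].
  unfold sin_approx, sin_term, cos_approx, cos_term in S1, S2, C1, C2.
  simpl in S1, S2, C1, C2.
  assert (S1' : u * (1 - u ^ 2 / 6) <= sin u) by lra.
  assert (S2' : sin u <= u - u ^ 3 / 6 + u ^ 5 / 120) by lra.
  assert (C1' : 1 - u ^ 2 / 2 <= cos u) by lra.
  assert (C2' : cos u <= 1 - u ^ 2 / 2 + u ^ 4 / 24) by lra.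
  clear S1 S2 C1 C2.
  assert (S3 : sin u < u) by (apply sin_lt_x; lra).
  assert (Hq : 0 < 1 - u ^ 2 / 6) by nra.
  assert (S0 : 0 < sin u) by nra.
  assert (Hd : 0 < u ^ 2 * sin u) by (apply Rmult_lt_0_compat; nra).
  assert (U1 : u * cos u <= u * (1 - u ^ 2 / 2 + u ^ 4 / 24)) by (apply Rmult_le_compat_l; lra).
  assert (U2 : u * (1 - u ^ 2 / 2) <= u * cos u) by (apply Rmult_le_compat_l; lra).
  split.
  - apply Rle_div_r; [exact Hd|].
    apply Rle_trans with ((1 / 3 - u ^ 2 / 24) * (u ^ 2 * u)); [|nra].
    apply Rmult_le_compat_l; [nra|]. apply Rmult_le_compat_l; nra.
  - apply Rle_div_l; [exact Hd|].
    apply Rle_trans with ((1 / 3 + u ^ 2 / 120) / (1 - u ^ 2 / 6) * (u ^ 2 * (u * (1 - u ^ 2 / 6)))).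
    + replace ((1 / 3 + u ^ 2 / 120) / (1 - u ^ 2 / 6) * (u ^ 2 * (u * (1 - u ^ 2 / 6))))
        with (u ^ 3 / 3 + u ^ 5 / 120) by (field; lra).
      nra.
    + apply Rmult_le_compat_l; [apply Rdiv_le_0_compat; nra|].
      apply Rmult_le_compat_l; nra.
Qed.

Lemma cot_defect_lim (u : nat -> R) : (forall n, 0 < u n <= 1) -> is_lim_seq u 0 ->
  is_lim_seq (fun n => (sin (u n) - u n * cos (u n)) / (u n ^ 2 * sin (u n))) (1 / 3).
Proof.
  intros Hu L.
  assert (L2 : is_lim_seq (fun n => u n ^ 2) 0).
  { replace (Finite 0) with (Finite (0 * (0 * 1))) by (f_equal; ring).
    apply is_lim_seq_mult'; [exact L|].
    apply is_lim_seq_mult'; [exact L|apply is_lim_seq_const]. }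
  assert (Lc : forall c, is_lim_seq (fun n => u n ^ 2 / c) (0 * / c)).
  { intros c. apply is_lim_seq_mult'; [exact L2|apply is_lim_seq_const]. }
  apply is_lim_seq_le_le with (1 := fun n => cot_defect_bounds (u n) (Hu n)).
  - replace (Finite (1 / 3)) with (Finite (1 / 3 - 0 * / 24)) by (f_equal; ring).
    apply is_lim_seq_minus'; [apply is_lim_seq_const|apply Lc].
  - replace (Finite (1 / 3)) with (Finite ((1 / 3 + 0 * / 120) / (1 - 0 * / 6)))
      by (f_equal; field).
    apply is_lim_seq_div'; [| |lra].
    + apply is_lim_seq_plus'; [apply is_lim_seq_const|apply Lc].
    + apply is_lim_seq_minus'; [apply is_lim_seq_const|apply Lc].
Qed.

(** The left side times [x ^ 2] is [S(0, 0) - S(x, 0)]. With [u = x * PI / 3] the closed form reads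
    [S(x, 0) = (2 sqrt 3 / PI) u cot u], and dividing by [x ^ 2 = 9 u^2 / PI^2] gives the constant
    on the right. *)
Lemma wz_series_defect (x : R) : 0 < x <= 1 / 2 ->
  Series (fun k => (1 + 8 * INR k) * wz 0 0 k * defect_slope x k) =
  2 * sqrt 3 * PI / 9 *
  ((sin (x * PI / 3) - x * PI / 3 * cos (x * PI / 3)) /
   ((x * PI / 3) ^ 2 * sin (x * PI / 3))).
Proof.
  intros Hx. pose proof PI_RGT_0 as HPI. pose proof PI_4 as HPI4.
  assert (H3 : 0 < sqrt 3) by (apply sqrt_lt_R0; lra).
  assert (H33 : sqrt 3 * sqrt 3 = 3) by (apply sqrt_sqrt; lra).
  assert (Hs : 0 < sin (x * PI / 3)) by (apply sin_gt_0; nra).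
  assert (E : x ^ 2 * Series (fun k => (1 + 8 * INR k) * wz 0 0 k * defect_slope x k) =
     Series (wz_term 0 0) - Series (wz_term x 0)).
  { rewrite <- Series_scal_l, <- Series_minus by (apply wz_term_ex_series; lra).
    apply Series_ext. intros k. unfold wz_term.
    rewrite (wz_defect x k) by lra.
    replace (defect x k) with (1 - x ^ 2 * defect_slope x k)
      by (rewrite <- defect_slope_eq by lra; ring).
    simpl (INR 0). field. }
  rewrite !wz_series_closed_form in E by lra.
  replace (2 * (0 / 3)) with 0 in E by field.
  replace (0 * PI / 3) with 0 in E by field.
  rewrite cosI_0_0, !cosI_0_eq, cos_0 in E by lra.
  replace (2 * (x / 3) * (PI / 2)) with (x * PI / 3) in E by field.
  replace (1 / 3 * (PI / 2)) with (PI / 6) in E by field.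
  rewrite sin_PI6 in E.
  apply Rmult_eq_reg_l with (x ^ 2); [|nra]. rewrite E.
  replace (2 / sqrt 3) with (2 * sqrt 3 / 3).
  2: { apply Rmult_eq_reg_r with (sqrt 3); [|lra].
       replace (2 * sqrt 3 / 3 * sqrt 3) with (2 * (sqrt 3 * sqrt 3) / 3) by field.
       rewrite H33. field. lra. }
  field. repeat split; lra.
Qed.

(* sum_{k>=1} term k = sqrt 3 * PI / 54, indexing k = n+1 *)
Theorem theorem1p2 :
  is_series (fun n : nat => term (S n)) (sqrt 3 * PI / 54).
Proof.
  (* The limit [x] to 0 is taken along [1 / (n + 2)], which stays in the range where all the bounds
     hold. *)
  assert (Hx : forall n, 0 < / (INR n + 2) <= 1 / 2).
  { intros n. pose proof (pos_INR n). split; [apply Rinv_0_lt_compat; lra|].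
    rewrite <- (Rinv_div 2 1). apply Rinv_le_contravar; lra. }
  destruct (tannery
    (fun n k => (1 + 8 * INR k) * wz 0 0 k * defect_slope (/ (INR n + 2)) k)
    (fun k => 4 * term k) (fun k => 180 * (9 / 16) ^ k)) as [Ev L].
  - intros n k.
    pose proof (defect_bounds (/ (INR n + 2)) k) as [_ [D1 D2]]; [split; [left|]; apply Hx|].
    pose proof (wz_bound 0 0 k ltac:(lra)) as [W1 W2]. pose proof (pos_INR k) as Hk.
    (* For [k >= 1] the factor [1 + 8k] is at most [9k] and the slope at most [5k]; then
       [180 = 45 * 4]. *)
    assert (P : 0 <= (1 + 8 * INR k) * defect_slope (/ (INR n + 2)) k <= 45 * INR k ^ 2).
    { split; [apply Rmult_le_pos; lra|].
      destruct k as [|k]; [simpl; lra|].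
      assert (1 <= INR (S k)) by (apply (le_INR 1); lia).
      replace (45 * INR (S k) ^ 2) with (9 * INR (S k) * (5 * INR (S k))) by ring.
      apply Rmult_le_compat; lra. }
    rewrite Rmult_assoc, (Rmult_comm (wz 0 0 k)), <- Rmult_assoc.
    rewrite Rabs_pos_eq by (apply Rmult_le_pos; lra).
    apply Rle_trans with (45 * (INR k ^ 2 * (1 / 4) ^ k)).
    + rewrite <- Rmult_assoc. apply Rmult_le_compat; lra.
    + pose proof (INR_sqr_quarter_le k). lra.
  - apply ex_series_quadratic_geom.
  - intros k.
    replace (4 * term k) with ((1 + 8 * INR k) * wz 0 0 k * (4 * inner k))
      by (rewrite wz_poch; unfold term; ring).
    apply is_lim_seq_mult'; [apply is_lim_seq_const|apply defect_lim].
  - pose proof PI_RGT_0 as HPI. pose proof PI_4 as HPI4.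
    assert (Lu : is_lim_seq (fun n => / (INR n + 2) * PI / 3) 0).
    { replace (Finite 0) with (Finite (0 * PI * / 3)) by (f_equal; ring).
      apply is_lim_seq_mult'; [|apply is_lim_seq_const].
      apply is_lim_seq_mult'; [apply is_lim_seq_inv_affine; lra|apply is_lim_seq_const]. }
    assert (L2 : is_lim_seq (fun n => Series (fun k =>
        (1 + 8 * INR k) * wz 0 0 k * defect_slope (/ (INR n + 2)) k))
        (2 * sqrt 3 * PI / 9 * (1 / 3))).
    { eapply is_lim_seq_ext; [intros n; symmetry; apply wz_series_defect, Hx|].
      apply is_lim_seq_mult'; [apply is_lim_seq_const|].
      apply (cot_defect_lim (fun n => / (INR n + 2) * PI / 3)); [|exact Lu].
      intros n. specialize (Hx n). nra. }
    (* Comparing the two limits, four times the series equals [2 * sqrt 3 * PI / 27]. *)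
    apply is_lim_seq_unique in L. apply is_lim_seq_unique in L2.
    rewrite L in L2. injection L2 as L2. rewrite Series_scal_l in L2.
    assert (Et : ex_series term).
    { apply (ex_series_ext (fun k => scal (/ 4) (4 * term k))).
      - intros k. unfold scal; simpl; unfold mult; simpl. field.
      - exact (ex_series_scal (/ 4) (fun k => 4 * term k) Ev). }
    assert (T : is_series term (sqrt 3 * PI / 54)).
    { replace (sqrt 3 * PI / 54) with (Series term) by lra. apply Series_correct, Et. }
    (* Starting at index 1 changes nothing, because [inner 0 = 0] makes [term 0] vanish. *)
    apply (is_series_incr_1 term).
    refine (eq_ind _ (is_series term) T _ _).
    change (sqrt 3 * PI / 54 = sqrt 3 * PI / 54 + term 0).
    unfold term; simpl; ring.
Qed.
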